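(* For any growth $\alpha$, the group $S^{comp}_\alpha(\omega)$ is not computably enumerable; that is, there is no surjection $\nu:\mathbb{N}\to S^{comp}_\alpha(\omega)$ for which the set $\{(i,j,k):\nu(i)\nu(j)=\nu(k)\}$ is computably enumerable.
   Context: $\Omega_\infty$ is the set of all $g:\mathbb{N}\cup\{\infty\}\to\mathbb{N}\cup\{\infty\}$ with $g(n+1)\ge g(n)>n$ for all $n\in\mathbb{N}$ and $g(\infty)=\infty$ (with $n<\infty$ for all $n$), a semigroup under composition. For $f,g\in\Omega_\infty$: $f\prec g$ iff $f(n)<g(n)$ for all sufficiently large $n$; $f\sim g$ iff there is $k$ with $f\prec g^k$ and $g\prec f^k$ (compositional powers). The $\sim$-classes are called growths. A permutation $\rho$ of $\mathbb{N}$ is bounded by $g\in\Omega_\infty$ if $\rho(m)\le g(n)$ for all $n$ and all $m\le n$. For a growth $\alpha$, $S^{comp}_\alpha(\omega)$ is the group of all permutations $\rho$ of $\mathbb{N}$ such that $\rho$ and $\rho^{-1}$ are computable and bounded by some $g\in\alpha$. *)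

(* Defs.v *)
From mathcomp Require Import all_boot.

Set Implicit Arguments.
Unset Strict Implicit.
Unset Printing Implicit Defensive.

Inductive recfn : nat -> Type :=
| RZero n : recfn n
| RSucc : recfn 1
| RProj n (i : 'I_n) : recfn n
| RComp m n (f : recfn m) (g : 'I_m -> recfn n) : recfn n
| RPrec n (b : recfn n) (s : recfn n.+2) : recfn n.+1
| RMin n (f : recfn n.+1) : recfn n.

Fixpoint prec_rel (b : nat -> Prop) (s : nat -> nat -> nat -> Prop)
    (k y : nat) : Prop :=
  if k is k'.+1 then exists2 z, prec_rel b s k' z & s k' z y else b y.

(* [reval p v y]: the computation of p on v halts with output y.
   In [RPrec b s] and [RMin f] the recursion (resp. search) variable is the
   first argument; s receives (k, value at k, parameters). *)
Fixpoint reval n (p : recfn n) : n.-tuple nat -> nat -> Prop :=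
  match p in recfn n return n.-tuple nat -> nat -> Prop with
  | RZero _ => fun _ y => y = 0
  | RSucc => fun v y => y = (thead v).+1
  | RProj _ i => fun v y => y = tnth v i
  | RComp m _ f g => fun v y =>
      exists2 w : m.-tuple nat,
        forall i, reval (g i) v (tnth w i) & reval f w y
  | RPrec _ b s => fun v y =>
      prec_rel (reval b [tuple of behead v])
        (fun k z => reval s [tuple of k :: z :: behead v]) (thead v) y
  | RMin _ f => fun v y =>
      reval f [tuple of y :: v] 0 /\
      forall z, z < y -> exists x, reval f [tuple of z :: v] x.+1
  end.

Definition computable (f : nat -> nat) : Prop :=
  exists p : recfn 1, forall x y, reval p [tuple x] y <-> y = f x.

(* Computably enumerable subsets of N^3, as domains of partial recursive
   functions. *)
Definition ce3 (A : nat -> nat -> nat -> Prop) : Prop :=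
  exists p : recfn 3,
    forall i j k, A i j k <-> exists y, reval p [tuple i; j; k] y.

Inductive natinf := Fin of nat | Infty.
Coercion Fin : nat >-> natinf.

Definition lei (x y : natinf) : bool :=
  match x, y with
  | _, Infty => true
  | Fin m, Fin n => m <= n
  | Infty, Fin _ => false
  end.

(* "n < oo for all n" is taken over all n in N u {oo}, so oo < oo holds.
   This makes [sim] reflexive on the functions that are eventually oo, which
   then form a growth; between the other functions it changes nothing. *)
Definition lti (x y : natinf) : bool :=
  match x, y with
  | _, Infty => true
  | Fin m, Fin n => m < n
  | Infty, Fin _ => false
  end.

Definition Omega_infty (g : natinf -> natinf) : Prop :=
  (forall n : nat, lei (g n) (g n.+1) /\ lti n (g n)) /\ g Infty = Infty.

Definition prec (f g : natinf -> natinf) : Prop :=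
  exists N : nat, forall n : nat, N <= n -> lti (f n) (g n).

Definition sim (f g : natinf -> natinf) : Prop :=
  exists k : nat, [/\ 0 < k, prec f (iter k g) & prec g (iter k f)].

Definition growth (alpha : (natinf -> natinf) -> Prop) : Prop :=
  exists2 f, Omega_infty f &
    forall g, alpha g <-> (Omega_infty g /\ sim f g).

Definition bounded (rho : nat -> nat) (g : natinf -> natinf) : Prop :=
  forall n m : nat, m <= n -> lei (rho m) (g n).

(* Permutations are represented by their underlying functions. *)
Definition Scomp (alpha : (natinf -> natinf) -> Prop) (rho : nat -> nat) :
    Prop :=
  exists rho' : nat -> nat,
    [/\ cancel rho rho', cancel rho' rho,
        computable rho, computable rho' &
        exists2 g, alpha g & bounded rho g /\ bounded rho' g].

Definition computably_enumerable (G : (nat -> nat) -> Prop) : Prop :=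
  exists nu : nat -> nat -> nat,
    [/\ forall i, G (nu i),
        forall rho, G rho -> exists i, nu i =1 rho &
        ce3 (fun i j k => nu i \o nu j =1 nu k)].

(* Main.v *)
(** Suppose [nu] enumerates the group with a c.e. multiplication table, and let
    [x_i] be the transposition of [4i] and [4i+2]. All permutations used here
    have bounded displacement, so they lie in the group whatever its growth is.
    A fixed permutation of the group conjugates each [x_i] to [x_(i+1)], so an
    index of [x_i] can be computed from [i], and it is semidecidable whether
    [nu i] commutes with [x_i]. So is the negation. Indeed
    [z = nu i x_i (nu i)^-1] is a transposition; if it differs from [x_i], some
    transposition [y] commutes with [x_i] and shares exactly one point with
    [z], so that some [u] of the group conjugates [z] and [y] to the fixed,
    noncommuting transpositions [(0 2)] and [(0 4)]; conversely such [y] and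
    [u] show that [z <> x_i]. The commutation is thus decidable, and the
    permutation that swaps [4i] and [4i+1] exactly for those [i] for which
    [nu i] commutes with [x_i] is in the group but is none of the [nu i]. *)

Require Import Defs.
From mathcomp Require Import all_boot.
From mathcomp Require Import zify.

Set Implicit Arguments.
Unset Strict Implicit.
Unset Printing Implicit Defensive.

(** * Total recursive functions *)

(** Plain sequences let arguments be rearranged by list operations without length proofs; only the
    values at sequences of length [n] matter. Decidable predicates are covered through the coercion
    of [bool] to [nat]. *)
Definition recursive n (F : seq nat -> nat) : Prop :=
  exists p : recfn n, forall (v : n.-tuple nat) y, reval p v y <-> y = F v.

Lemma recursive_ext n (F G : seq nat -> nat) :
  (forall v, size v = n -> F v = G v) -> recursive n F -> recursive n G.
Proof.
move=> FG [p pP]; exists p => v y.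
by rewrite pP FG ?size_tuple.
Qed.

Lemma recursive_comp m n (F : seq nat -> nat) (T : seq nat -> seq nat) :
  recursive m F -> (forall v, size v = n -> size (T v) = m) ->
  (forall i, i < m -> recursive n (fun v => nth 0 (T v) i)) ->
  recursive n (fun v => F (T v)).
Proof.
move=> [p pP] sT recT.
have /fin_all_exists[g gP] (i : 'I_m) : exists q : recfn n,
    forall (v : n.-tuple nat) y, reval q v y <-> y = nth 0 (T v) i.
  by have [q qP] := recT i (ltn_ord i); exists q.
exists (RComp p g) => v y /=; split=> [[w wP /pP->]|->].
  congr F; apply: (@eq_from_nth _ 0) => [|i].
    by rewrite size_tuple sT ?size_tuple.
  rewrite size_tuple => lt_im.
  have /gP := wP (Ordinal lt_im).
  by rewrite (tnth_nth 0).
have sTv : size (T v) == m by rewrite sT ?size_tuple.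
exists (Tuple sTv); last exact/pP.
by move=> i; apply/gP; rewrite (tnth_nth 0).
Qed.

Lemma recursive0 n : recursive n (fun=> 0).
Proof. by exists (RZero n). Qed.

Lemma recursive_nth n i : recursive n (fun v => nth 0 v i).
Proof.
case: (ltnP i n) => [lt_in|le_ni].
  by exists (RProj (Ordinal lt_in)) => v y /=; rewrite (tnth_nth 0).
apply: recursive_ext (recursive0 n) => v sv.
by rewrite nth_default // sv.
Qed.

Lemma recursive_nth_iter n k i : recursive n (fun v => nth 0 (iter k behead v) i).
Proof.
apply: recursive_ext (recursive_nth n (k + i)) => v _.
by elim: k i => [|k IHk] i //=; rewrite nth_behead -IHk addSnnS.
Qed.

Lemma recursive_succ n F : recursive n F -> recursive n (fun v => (F v).+1).
Proof.
move=> recF.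
have recS : recursive 1 (fun v => (nth 0 v 0).+1).
  by exists RSucc => v y /=; rewrite /thead (tnth_nth 0).
by apply: (recursive_comp (T := fun v => [:: F v]) recS) => // -[].
Qed.

Lemma recursive_const n c : recursive n (fun=> c).
Proof. by elim: c => [|c]; [apply: recursive0 | apply: recursive_succ]. Qed.

Lemma prec_rel_iteri (b : nat -> Prop) (s : nat -> nat -> nat -> Prop) B S k y :
  (forall y, b y <-> y = B) -> (forall k z y, s k z y <-> y = S k z) ->
  prec_rel b s k y <-> y = iteri k S B.
Proof.
move=> bP sP; elim: k y => [|k IHk] y //=.
split=> [[z /IHk-> /sP//]|->].
by exists (iteri k S B); [apply/IHk | apply/sP].
Qed.

Lemma recursive_iteri n E B S :
  recursive n E -> recursive n B -> recursive n.+2 S ->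
  recursive n (fun v => iteri (E v) (fun k z => S (k :: z :: v)) (B v)).
Proof.
move=> recE [b bP] [s sP].
(* Primitive recursion runs on the first argument, so the count is first made an extra argument, and
   [E v] is substituted for it afterwards. *)
have recI : recursive n.+1 (fun v =>
    iteri (head 0 v) (fun k z => S (k :: z :: behead v)) (B (behead v))).
  exists (RPrec b s) => v y; rewrite -/(reval _).
  have -> : head 0 v = thead v by rewrite /thead (tnth_nth 0) nth0.
  apply: prec_rel_iteri => [z|k z x].
    exact: (bP [tuple of behead v]).
  exact: (sP [tuple of k :: z :: behead v]).
apply: (recursive_comp (T := fun v => E v :: v) recI) => [v /= ->//|[|i] _ //=].
exact: recursive_nth.
Qed.

Lemma recursive_behead n F : recursive n F -> recursive n.+1 (fun v => F (behead v)).
Proof.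
move=> recF; apply: (recursive_comp recF) => [v sv|i _].
  by rewrite size_behead sv.
exact: (recursive_nth_iter _ 1).
Qed.

Lemma recursive_ifz n C A B :
  recursive n C -> recursive n A -> recursive n B ->
  recursive n (fun v => if C v == 0 then A v else B v).
Proof.
move=> recC recA recB.
have := recursive_iteri recC recA (recursive_behead (recursive_behead recB)).
by apply: recursive_ext => v _; case: (C v).
Qed.

Lemma recursive_if n (b : seq nat -> bool) A B :
  recursive n b -> recursive n A -> recursive n B ->
  recursive n (fun v => if b v then A v else B v).
Proof.
move=> recb recA recB.
by apply: recursive_ext (recursive_ifz recb recB recA) => v _; case: (b v).
Qed.

Lemma recursive_add n F G :
  recursive n F -> recursive n G -> recursive n (fun v => F v + G v).
Proof.
move=> recF recG.
have := recursive_iteri recF recG (recursive_succ (recursive_nth _ 1)).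
apply: recursive_ext => v _ /=; elim: (F v) => //= k ->.
by rewrite addSn.
Qed.

Lemma recursive_pred n F : recursive n F -> recursive n (fun v => (F v).-1).
Proof.
move=> recF.
have := recursive_iteri recF (recursive0 n) (recursive_nth _ 0).
by apply: recursive_ext => v _; case: (F v).
Qed.

Lemma recursive_sub n F G :
  recursive n F -> recursive n G -> recursive n (fun v => F v - G v).
Proof.
move=> recF recG.
have := recursive_iteri recG recF (recursive_pred (recursive_nth _ 1)).
apply: recursive_ext => v _ /=; elim: (G v) => [|k IHk] /=; by [rewrite subn0 | rewrite IHk subnS].
Qed.

Lemma recursive_mul n F G :
  recursive n F -> recursive n G -> recursive n (fun v => F v * G v).
Proof.
move=> recF recG.
have recS : recursive n.+2 (fun v => nth 0 v 1 + G (behead (behead v))).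
  apply: recursive_add (recursive_nth _ 1) _.
  exact: recursive_behead (recursive_behead recG).
have := recursive_iteri recF (recursive0 n) recS.
apply: recursive_ext => v _ /=; elim: (F v) => //= k ->; lia.
Qed.

Lemma recursive_prod n m (F : 'I_m -> seq nat -> nat) :
  (forall i, recursive n (F i)) -> recursive n (fun v => \prod_i F i v).
Proof.
elim: m F => [|m IHm] F recF.
  by apply: recursive_ext (recursive_const n 1) => v _; rewrite big_ord0.
have := recursive_mul (recF ord0) (IHm _ (fun i => recF (lift ord0 i))).
by apply: recursive_ext => v _; rewrite big_ord_recl.
Qed.

Lemma recursive_leq n F G :
  recursive n F -> recursive n G -> recursive n (fun v => F v <= G v).
Proof.
move=> recF recG.
have := recursive_ifz (recursive_sub recF recG) (recursive_const n 1) (recursive0 n).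
by apply: recursive_ext => v _; rewrite subn_eq0; case: leqP.
Qed.

Lemma recursive_neg n (b : seq nat -> bool) :
  recursive n b -> recursive n (fun v => ~~ b v).
Proof.
move=> recb; apply: recursive_ext (recursive_ifz recb (recursive_const n 1) (recursive0 n)).
by move=> v _; case: (b v).
Qed.

Lemma recursive_and n (b c : seq nat -> bool) :
  recursive n b -> recursive n c -> recursive n (fun v => b v && c v).
Proof.
move=> recb recc; apply: recursive_ext (recursive_mul recb recc) => v _.
by rewrite mulnb.
Qed.

Lemma recursive_or n (b c : seq nat -> bool) :
  recursive n b -> recursive n c -> recursive n (fun v => b v || c v).
Proof.
move=> /recursive_neg recb /recursive_neg recc.
apply: recursive_ext (recursive_neg (recursive_and recb recc)) => v _.
by rewrite negb_and !negbK.
Qed.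

Lemma recursive_eq n F G :
  recursive n F -> recursive n G -> recursive n (fun v => F v == G v).
Proof.
move=> recF recG.
have := recursive_and (recursive_leq recF recG) (recursive_leq recG recF).
by apply: recursive_ext => v _; rewrite eqn_leq.
Qed.

Lemma recursive_has n E (b : seq nat -> bool) :
  recursive n E -> recursive n.+1 b ->
  recursive n (fun v => has (fun x => b (x :: v)) (iota 0 (E v))).
Proof.
move=> recE recb.
have recS : recursive n.+2 (fun v =>
    (0 < nth 0 v 1) || b (nth 0 v 0 :: behead (behead v))).
  apply: recursive_or.
    by apply: recursive_leq; [apply: recursive_const | apply: recursive_nth].
  apply: (recursive_comp recb) => [v sv|[|i] _ /=].
  - by rewrite /= !size_behead sv.
  - exact: recursive_nth.
  - exact: (recursive_nth_iter _ 2).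
have := recursive_iteri recE (recursive0 n) recS.
apply: recursive_ext => v _; elim: (E v) => // k IHk.
by rewrite [LHS]/= IHk -[k.+1]addn1 iotaD has_cat /= orbF lt0b.
Qed.

Lemma recursive_min n (b : seq nat -> bool) :
  recursive n.+1 b -> (forall v, size v = n -> exists x, b (x :: v)) ->
  exists2 h, recursive n h & forall v, size v = n ->
    b (h v :: v) /\ forall x, b (x :: v) -> h v <= x.
Proof.
move=> /recursive_neg[p pP] exb.
(* The least witness of a decidable predicate can be extracted from mere existence; the value 0 at
   other lengths is a dummy. As [RMin] searches for a zero, the program used below is that of the
   negation of [b]. *)
pose h v := if size v =P n is ReflectT sv then ex_minn (exb v sv) else 0.
have hP v : size v = n -> b (h v :: v) /\ forall x, b (x :: v) -> h v <= x.
  by move=> sv; rewrite /h; case: eqP => // {}sv; case: ex_minnP.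
exists h => //; exists (RMin p) => v y /=.
have [bh minh] := hP v (size_tuple v).
split=> [[/pP/= by0 ltyP]|->].
  apply/eqP; rewrite eqn_leq minh ?andbT; last by move: by0; case: (b _).
  rewrite leqNgt; apply/negP => /ltyP[x /pP/=].
  by rewrite bh.
split=> [|z lt_zh]; first by apply/pP; rewrite /= bh.
exists 0; apply/pP => /=; case bz: (b _) => //.
by have := minh z bz; rewrite leqNgt lt_zh.
Qed.

Lemma recursive1_comp n f F : recursive 1 (fun v => f (nth 0 v 0)) ->
  recursive n F -> recursive n (fun v => f (F v)).
Proof.
by move=> recf recF; apply: (recursive_comp (T := fun v => [:: F v]) recf) => // -[].
Qed.

(** * Computations with bounded search *)

(* The fuel [s] bounds the number of candidates tried by each unbounded search;
   the result is [0] if the computation fails within this bound and [y.+1] if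
   it returns [y]. In a search, the state is [0] while running, [1] once stuck
   on an undefined value and [y.+2] once [y] is found. *)
Definition search (phi : nat -> nat) (s : nat) : nat :=
  iteri s (fun k st =>
    if st == 0 then
      if phi k == 0 then 1 else if phi k == 1 then k.+2 else 0
    else st) 0.

(** The product in [RComp] vanishes as soon as one argument fails; without this test, [.-1] would
    turn a failure into the value 0. In [RMin], the outer [.-1] merges the running and stuck states
    into 0 and leaves [y.+1] once [y] is found. *)
Fixpoint ev n (p : recfn n) (s : nat) (v : seq nat) : nat :=
  match p with
  | RZero _ => 1
  | RSucc => (nth 0 v 0).+2
  | RProj _ i => (nth 0 v i).+1
  | RComp m _ f g =>
      if \prod_(i < m) ev (g i) s v == 0 then 0
      else ev f s [seq (ev (g i) s v).-1 | i <- enum 'I_m]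
  | RPrec _ b t =>
      iteri (nth 0 v 0)
        (fun k z => if z == 0 then 0 else ev t s (k :: z.-1 :: behead v))
        (ev b s (behead v))
  | RMin _ f => (search (fun k => ev f s (k :: v)) s).-1
  end.

Lemma search0P phi s :
  reflect (forall z, z < s -> 1 < phi z) (search phi s == 0).
Proof.
elim: s => [|s IHs] /=; first by left.
case: ifPn => [/IHs lts|nz]; last first.
  rewrite (negbTE nz); right=> lts; move/IHs: nz; apply=> z lt_zs.
  exact/lts/ltnW.
case: (ltnP 1 (phi s)) => [gt1|le1].
  case E: (phi s) gt1 => [|[|r]] //= _; left=> z.
  by rewrite ltnS leq_eqVlt => /orP[/eqP->|/lts//]; rewrite E.
by case E: (phi s) le1 => [|[|r]] //= _; right=> /(_ s (leqnn _)); rewrite E.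
Qed.

Lemma searchP phi s y :
  search phi s = y.+2 <->
  [/\ y < s, phi y = 1 & forall z, z < y -> 1 < phi z].
Proof.
elim: s => [|s IHs] /=; first by split=> // -[].
case: ifP => [/search0P lts|nz].
  have -> : [/\ y < s.+1, phi y = 1 & forall z, z < y -> 1 < phi z] <->
            y = s /\ phi s = 1.
    split=> [[le_ys phiy _]|[-> phis]]; last by split.
    move: le_ys; rewrite ltnS leq_eqVlt => /orP[/eqP<-//|/lts].
    by rewrite phiy.
  case: (phi s) => [|[|r]] /=; split=> //; by [case | case=> ->].
rewrite IHs; split=> -[lt_ys phiy lty]; split=> //; first exact: ltnW.
move: lt_ys; rewrite ltnS leq_eqVlt => /orP[/eqP ys|//].
by move/search0P: nz; rewrite -ys.
Qed.

Lemma recursive_ev n (p : recfn n) :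
  recursive n.+1 (fun v => ev p (nth 0 v 0) (behead v)).
Proof.
elim: p => {n} [n||n i|m n f IHf g IHg|n b IHb t IHt|n f IHf].
- exact: recursive_const.
- do 2!apply: recursive_succ; exact: (recursive_nth_iter _ 1).
- apply: recursive_succ; exact: (recursive_nth_iter _ 1).
- apply: recursive_ifz; first exact: recursive_prod.
    exact: recursive0.
  apply: (recursive_comp (T := fun v => nth 0 v 0 ::
    [seq (ev (g i) (nth 0 v 0) (behead v)).-1 | i <- enum 'I_m]) IHf) => [v _|].
    by rewrite /= size_map size_enum_ord.
  case=> [|i] /=; first by move=> _; apply: recursive_nth.
  rewrite ltnS => lt_im; apply: recursive_ext (recursive_pred (IHg (Ordinal lt_im))) => v _.
  rewrite (nth_map (Ordinal lt_im)) ?size_enum_ord //.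
  by rewrite (nth_ord_enum _ (Ordinal lt_im)).
- have recE : recursive n.+2 (fun v => nth 0 v 1) by exact: recursive_nth.
  have recB : recursive n.+2 (fun v => ev b (nth 0 v 0) (behead (behead v))).
    apply: (recursive_comp (T := fun v => nth 0 v 0 :: behead (behead v)) IHb).
      by move=> v sv; rewrite /= !size_behead sv.
    by case=> [|i] _ /=; [apply: recursive_nth | apply: (recursive_nth_iter _ 2)].
  (* Here [w] lists the step, the previous result, the fuel, the recursion argument, and then the
     parameters. *)
  have recS : recursive n.+4 (fun w => if nth 0 w 1 == 0 then 0 else
      ev t (nth 0 w 2)
        (nth 0 w 0 :: (nth 0 w 1).-1 :: behead (behead (behead (behead w))))).
    apply: recursive_ifz; [exact: recursive_nth | exact: recursive0 |].
    apply: (recursive_comp (T := fun w => nth 0 w 2 :: nth 0 w 0 ::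
      (nth 0 w 1).-1 :: behead (behead (behead (behead w)))) IHt).
      by move=> v sv; rewrite /= !size_behead sv.
    case=> [|[|[|i]]] _ /=; try exact: recursive_nth.
      exact/recursive_pred/recursive_nth.
    exact: (recursive_nth_iter _ 4).
  apply: recursive_ext (recursive_iteri recE recB recS) => v _ /=.
  by rewrite nth_behead.
- apply: recursive_pred; rewrite /search.
  have recF : recursive n.+3 (fun w =>
      ev f (nth 0 w 2) (nth 0 w 0 :: behead (behead (behead w)))).
    apply: (recursive_comp (T := fun w => nth 0 w 2 :: nth 0 w 0 ::
      behead (behead (behead w))) IHf).
      by move=> v sv; rewrite /= !size_behead sv.
    case=> [|[|i]] _ /=; try exact: recursive_nth.
    exact: (recursive_nth_iter _ 3).
  have recS : recursive n.+3 (fun w =>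
      let r := ev f (nth 0 w 2) (nth 0 w 0 :: behead (behead (behead w))) in
      if nth 0 w 1 == 0 then
        if r == 0 then 1 else if r == 1 then (nth 0 w 0).+2 else 0
      else nth 0 w 1).
    apply: recursive_ifz; try exact: recursive_nth.
    apply: recursive_ifz => //; first exact: recursive_const.
    apply: recursive_if; last exact: recursive0.
      by apply: recursive_eq => //; apply: recursive_const.
    exact/recursive_succ/recursive_succ/recursive_nth.
  exact: (recursive_iteri (recursive_nth _ 0) (recursive0 _) recS).
Qed.

(** Fuel matters only in [RMin]. When a search succeeds, every candidate up to the one found has
    returned a value, and by induction it returns the same value with more fuel. *)
Lemma ev_mono n (p : recfn n) s s' v y :
  s <= s' -> ev p s v = y.+1 -> ev p s' v = y.+1.
Proof.
move=> le_ss'.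
elim: p v y => {n} [n||n i|m n f IHf g IHg|n b IHb t IHt|n f IHf] v y //=.
- case: ifPn => // nz evf.
  have evg i : ev (g i) s' v = ev (g i) s v.
    have: ev (g i) s v != 0.
      by apply: contraNneq nz => ev0; rewrite (bigD1 i) //= ev0.
    by case E: (ev (g i) s v) => [|x] // _; apply: IHg.
  under eq_bigr do rewrite evg.
  rewrite (negbTE nz) -(IHf _ _ evf).
  by congr ev; apply: eq_map => i; rewrite evg.
- elim: (nth 0 v 0) y => [|k IHk] y /=; first exact: IHb.
  set z := iteri k _ (ev b s _) in IHk *.
  case: z IHk => [|z] IHk //= evt.
  by rewrite (IHk z) //=; apply: IHt.
- set r := search _ s; case E: r => [|[|x]] //= [<-].
  have /searchP[lt_xs evx ltx] := E.
  have /searchP-> // : [/\ x < s', ev f s' (x :: v) = 1 &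
      forall z, z < x -> 1 < ev f s' (z :: v)].
  split; [exact: leq_trans le_ss' | exact: IHf |].
  move=> z /ltx; case Ez: (ev f s (z :: v)) => [|[|w]] // _.
  by rewrite (IHf _ _ Ez).
Qed.

(** Merges the fuels of finitely many computations: the arguments of a composition, or the
    candidates rejected by a search. *)
Lemma uniform_fuel (P : nat -> nat -> Prop) n :
  (forall z s s', s <= s' -> P z s -> P z s') ->
  (forall z, z < n -> exists s, P z s) -> exists s, forall z, z < n -> P z s.
Proof.
move=> Pmono; elim: n => [|n IHn] exP; first by exists 0.
have [s sP] := IHn (fun z lt_zn => exP z (ltnW lt_zn)).
have [s' s'P] := exP n (leqnn _).
exists (maxn s s') => z; rewrite ltnS leq_eqVlt => /orP[/eqP->|/sP].
  by apply: Pmono s'P; rewrite leq_maxr.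
by apply: Pmono; rewrite leq_maxl.
Qed.

(** Together with [recursive_ev] this plays the role of a normal form theorem: for a fixed program,
    halting becomes a recursive test of the fuel, and no coding of programs is required. *)
Lemma reval_ev n (p : recfn n) (v : n.-tuple nat) y :
  reval p v y <-> exists s, ev p s v = y.+1.
Proof.
elim: p v y => {n} [n||n i|m n f IHf g IHg|n b IHb t IHt|n f IHf] v y /=.
- by split=> [->|[_ [<-]]]; first by exists 0.
- by rewrite /thead (tnth_nth 0); split=> [->|[_ [<-]]]; first by exists 0.
- by rewrite (tnth_nth 0); split=> [->|[_ [<-]]]; first by exists 0.
- split=> [[w gw /IHf[s1 evf]]|[s]].
    have [|z lt_zm|s2 evg] := @uniform_fuel
        (fun z s => forall i : 'I_m, z = i -> ev (g i) s v = (tnth w i).+1) m.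
    + by move=> z s s' le_ss' Pz i /Pz; apply: ev_mono.
    + have /IHg[s evs] := gw (Ordinal lt_zm).
      exists s => i eq_zi; suff -> : i = Ordinal lt_zm by [].
      exact: val_inj.
    have {}evg i : ev (g i) (maxn s1 s2) v = (tnth w i).+1.
      by apply: ev_mono (evg i (ltn_ord i) i erefl); rewrite leq_maxr.
    exists (maxn s1 s2); under eq_bigr do rewrite evg.
    rewrite gtn_eqF ?prodn_gt0 //.
    suff -> : [seq (ev (g i) (maxn s1 s2) v).-1 | i <- enum 'I_m] = w.
      by apply: ev_mono evf; rewrite leq_maxl.
    rewrite -[RHS](map_tnth_enum w); apply: eq_map => i.
    by rewrite evg.
  case: ifPn => // nz evf.
  have sw : size [seq (ev (g i) s v).-1 | i <- enum 'I_m] == m.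
    by rewrite size_map size_enum_ord.
  exists (Tuple sw); last by apply/IHf; exists s.
  move=> i; apply/IHg; exists s.
  rewrite (tnth_nth 0) /= (nth_map i) ?size_enum_ord // nth_ord_enum prednK //.
  by rewrite lt0n; apply: contraNneq nz => ev0; rewrite (bigD1 i) //= ev0.
- rewrite /thead (tnth_nth 0) /=.
  elim: (nth 0 v 0) y => [|k IHk] y /=; first exact: IHb.
  split=> [[z /IHk[s1 ev1] /IHt[s2 ev2]]|[s]].
    exists (maxn s1 s2).
    have := @ev_mono _ (RPrec b t) s1 (maxn s1 s2) (k :: behead v) z (leq_maxl _ _).
    move=> /= -> //; apply: ev_mono ev2; exact: leq_maxr.
  set z := iteri _ _ _; case E: z => [|x] //= evt.
  by exists x; [apply/IHk; exists s | apply/IHt; exists s].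
- split=> [[/IHf/=[s1 ev1] ltyP]|[s]].
    have [|z lt_zy|s2 ev2] := @uniform_fuel (fun z s => 1 < ev f s (z :: v)) y.
    + move=> z s s' le_ss'; case E: (ev f s (z :: v)) => [|[|x]] // _.
      by rewrite (ev_mono le_ss' E).
    + by have [x /IHf[s evs]] := ltyP z lt_zy; exists s; rewrite evs.
    (* The fuel also has to exceed [y], since only candidates below it are tried. *)
    pose s := maxn y.+1 (maxn s1 s2).
    exists s; suff /searchP-> : [/\ y < s, ev f s (y :: v) = 1 &
      forall z, z < y -> 1 < ev f s (z :: v)] by [].
    split; first by rewrite leq_maxl.
      by apply: ev_mono ev1; rewrite /s; lia.
    move=> z /ev2; case E: (ev f s2 (z :: v)) => [|[|x]] // _.
    by rewrite (@ev_mono _ f s2 s _ _ _ E) // /s; lia.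
  set r := search _ s; case E: r => [|[|x]] //= [<-].
  have /searchP[lt_xs evx ltx] := E.
  split; first by apply/IHf; exists s.
  move=> z /ltx; case Ez: (ev f s (z :: v)) => [|[|w]] // _.
  by exists w; apply/IHf; exists s.
Qed.

(** * Semidecidable relations *)

(** The head of the sequence is a stage. Monotonicity in it lets several confirmations be brought to
    one common stage, so conjunctions and existential quantifiers need no pairing function. *)
Definition semidec n (R : seq nat -> Prop) : Prop :=
  exists b : seq nat -> bool,
    [/\ recursive n.+1 b,
        forall v s s', size v = n -> s <= s' -> b (s :: v) -> b (s' :: v) &
        forall v, size v = n -> R v <-> exists s, b (s :: v)].

Lemma semidec_ext n (R Q : seq nat -> Prop) :
  (forall v, size v = n -> R v <-> Q v) -> semidec n R -> semidec n Q.
Proof.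
move=> RQ [b [recb bmono bP]]; exists b; split=> // v sv.
by rewrite -RQ // bP.
Qed.

Lemma semidec_comp m n (R : seq nat -> Prop) (T : seq nat -> seq nat) :
  semidec m R -> (forall v, size v = n -> size (T v) = m) ->
  (forall i, i < m -> recursive n (fun v => nth 0 (T v) i)) ->
  semidec n (fun v => R (T v)).
Proof.
move=> [b [recb bmono bP]] sT recT.
exists (fun w => b (nth 0 w 0 :: T (behead w))); split=> [|v s s' sv|v sv].
- apply: (recursive_comp (T := fun w => nth 0 w 0 :: T (behead w)) recb).
    by move=> v sv /=; rewrite sT // size_behead sv.
  case=> [|i] lt_im /=; first exact: recursive_nth.
  exact: recursive_behead (recT i lt_im).
- by apply: bmono; rewrite sT.
- by rewrite bP ?sT.
Qed.

Lemma semidec_dec n (b : seq nat -> bool) : recursive n b -> semidec n b.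
Proof.
move=> recb; exists (fun w => b (behead w)); split=> //.
  exact: recursive_behead recb.
by move=> v _ /=; split=> [bv|[]//]; exists 0.
Qed.

Lemma semidec_and n R Q :
  semidec n R -> semidec n Q -> semidec n (fun v => R v /\ Q v).
Proof.
move=> [b [recb bmono bP]] [c [recc cmono cP]].
exists (fun w => b w && c w); split=> [|v s s' sv le_ss'|v sv].
- exact: recursive_and.
- by case/andP=> /(bmono _ _ _ sv le_ss')-> /(cmono _ _ _ sv le_ss')->.
rewrite bP // cP //; split=> [[[s bs] [s' cs']]|[s /andP[bs cs]]].
  exists (maxn s s'); rewrite (bmono _ s) ?leq_maxl //=.
  by rewrite (cmono _ s') ?leq_maxr.
by split; exists s.
Qed.

Lemma semidec_or n R Q :
  semidec n R -> semidec n Q -> semidec n (fun v => R v \/ Q v).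
Proof.
move=> [b [recb bmono bP]] [c [recc cmono cP]].
exists (fun w => b w || c w); split=> [|v s s' sv le_ss'|v sv].
- exact: recursive_or.
- case/orP=> [/(bmono _ _ _ sv le_ss')->//|/(cmono _ _ _ sv le_ss')->].
  by rewrite orbT.
rewrite bP // cP //; split=> [[] [s bs]|[s /orP[]]].
- by exists s; rewrite bs.
- by exists s; rewrite bs orbT.
- by left; exists s.
- by right; exists s.
Qed.

(** This is dovetailing: the stage [nth 0 w 0] bounds the witness as well as the time allowed to
    confirm it. *)
Lemma semidec_ex_has n (b : seq nat -> bool) :
  recursive n.+2 b ->
  recursive n.+1 (fun w => has (fun x => b (nth 0 w 0 :: x :: behead w))
                               (iota 0 (nth 0 w 0))).
Proof.
move=> recb.
have recb' : recursive n.+2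
    (fun w => b (nth 0 w 1 :: nth 0 w 0 :: behead (behead w))).
  apply: (recursive_comp (T := fun w => nth 0 w 1 :: nth 0 w 0 ::
    behead (behead w)) recb) => [v sv|]; first by rewrite /= !size_behead sv.
  case=> [|[|i]] _ /=; try exact: recursive_nth.
  exact: (recursive_nth_iter _ 2).
exact: recursive_has (recursive_nth _ 0) recb'.
Qed.

Lemma semidec_ex n (R : nat -> seq nat -> Prop) :
  semidec n.+1 (fun w => R (nth 0 w 0) (behead w)) ->
  semidec n (fun v => exists x, R x v).
Proof.
move=> [b [recb bmono bP]].
exists (fun w => has (fun x => b (nth 0 w 0 :: x :: behead w))
                     (iota 0 (nth 0 w 0))); split=> [|v s s' sv le_ss'|v sv].
- exact: semidec_ex_has.
- case/hasP=> x; rewrite mem_iota /= => lt_xs bx; apply/hasP; exists x.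
    by rewrite mem_iota /= (leq_trans lt_xs).
  by apply: bmono bx; rewrite //= sv.
split=> [[x Rx]|[s /hasP[x _ bx]]].
  have [] := bP (x :: v); rewrite /= ?sv // => /(_ Rx)[s bs] _.
  exists (maxn s x.+1); apply/hasP; exists x; first by rewrite mem_iota /=; lia.
  by apply: bmono bs; rewrite /= ?sv ?leq_maxl.
by exists x; apply/(bP (x :: v)); rewrite /= ?sv //; exists s.
Qed.

(** Two successive searches replace a search for pairs: first for a stage at which some witness is
    confirmed, then for the least witness confirmed at that stage. *)
Lemma semidec_uniformize n (R : nat -> seq nat -> Prop) :
  semidec n.+1 (fun w => R (nth 0 w 0) (behead w)) ->
  (forall v, size v = n -> exists x, R x v) ->
  exists2 h, recursive n h & forall v, size v = n -> R (h v) v.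
Proof.
move=> [b [recb bmono bP]] exR.
have [v sv|s recs sP] := recursive_min (semidec_ex_has recb).
  have [x Rx] := exR v sv.
  have [] := bP (x :: v); rewrite /= ?sv // => /(_ Rx)[s bs] _.
  exists (maxn s x.+1); apply/hasP; exists x; first by rewrite mem_iota /=; lia.
  by apply: bmono bs; rewrite /= ?sv ?leq_maxl.
have recb' : recursive n.+1 (fun w => b (s (behead w) :: w)).
  apply: (recursive_comp (T := fun w => s (behead w) :: w) recb).
    by move=> v /= ->.
  by case=> [|i] _ /=; [apply: recursive_behead recs | apply: recursive_nth].
have [v sv|h rech hP] := recursive_min recb'.
  by have [/hasP[x _ bx] _] := sP v sv; exists x.
exists h => // v sv; apply/(bP (h v :: v)); first by rewrite /= sv.
by exists (s v); have [] := hP v sv.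
Qed.

Lemma semidec_ce3 A : ce3 A ->
  semidec 3 (fun v => A (nth 0 v 0) (nth 0 v 1) (nth 0 v 2)).
Proof.
move=> [p pP]; exists (fun w => 0 < ev p (nth 0 w 0) (behead w)).
split=> [|v s s' _ le_ss' /=|].
- exact: recursive_leq (recursive_const _ _) (recursive_ev p).
- by case E: (ev p s v) => [|y] // _; rewrite (ev_mono le_ss' E).
case=> [|i [|j [|k []]]] //= _; rewrite pP.
split=> [[y /reval_ev[s evs]]|[s]]; first by exists s; rewrite evs.
case E: (ev p s _) => [|y] // _; exists y; apply/reval_ev; by exists s.
Qed.

(** * Groups of permutations of given growth *)

Lemma computableP f : computable f <-> recursive 1 (fun v => f (nth 0 v 0)).
Proof.
split=> -[p pP]; last by exists p => x y; apply: (pP [tuple x]).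
exists p => v y; have {1}-> : v = [tuple nth 0 v 0]; last exact: pP.
by apply: val_inj; case: v => -[|a []].
Qed.

Lemma computable_comp f g : computable f -> computable g -> computable (f \o g).
Proof.
move=> /computableP recf /computableP recg; apply/computableP.
exact: recursive1_comp recf recg.
Qed.

Lemma lei_trans y x z : lei x y -> lei y z -> lei x z.
Proof. by case: x y z => [x|] [y|] [z|] //=; apply: leq_trans. Qed.

Lemma lei_lti_trans y x z : lei x y -> lti y z -> lti x z.
Proof. by case: x y z => [x|] [y|] [z|] //=; apply: leq_ltn_trans. Qed.

Lemma ltiW x y : lti x y -> lei x y.
Proof. by case: x y => [x|] [y|] //=; apply: ltnW. Qed.

(** * Iterates of a function in [Omega_infty] *)

Section OmegaIter.

Variables (f : natinf -> natinf) (Of : Omega_infty f).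

Lemma Omega_lti x : lti x (f x).
Proof. by case: Of => fP fI; case: x => [n|]; [case: (fP n) | rewrite fI]. Qed.

Lemma Omega_lei x y : lei x y -> lei (f x) (f y).
Proof.
case: Of => fP fI; case: y => [n|]; last by rewrite fI; case: (f x).
case: x => [m|] //=; elim: n => [|n IHn].
  by rewrite leqn0 => /eqP->; case: (f _) => /=.
rewrite leq_eqVlt => /orP[/eqP->|/IHn le_f]; first by case: (f _) => /=.
by apply: lei_trans le_f _; case: (fP n).
Qed.

Lemma iter_Omega_lei k x y : lei x y -> lei (iter k f x) (iter k f y).
Proof. by move=> le_xy; elim: k => //= k; apply: Omega_lei. Qed.

Lemma iter_Omega_leq k l x : k <= l -> lei (iter k f x) (iter l f x).
Proof.
move/subnK <-; elim: (l - k) => [|j IHj]; first by case: (iter _ _ _) => /=.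
by apply: lei_trans IHj _; apply/ltiW/Omega_lti.
Qed.

Lemma iter_Omega_ltn k l x : k < l -> lti (iter k f x) (iter l f x).
Proof.
case: l => // l; rewrite ltnS => le_kl; apply: lei_lti_trans (iter_Omega_leq x le_kl) _.
exact: Omega_lti.
Qed.

Lemma iter_Omega_add k (n : nat) : lei (n + k) (iter k f n).
Proof.
elim: k => [|k IHk] /=; first by rewrite addn0.
have := lei_lti_trans IHk (Omega_lti _).
by rewrite addnS; case: (f _).
Qed.

Lemma Omega_infty_iter k : 0 < k -> Omega_infty (iter k f).
Proof.
move=> k_gt0; split=> [n|]; first split.
- by apply: iter_Omega_lei => /=.
- exact: (iter_Omega_ltn n k_gt0).
- by elim: k {k_gt0} => //= k ->; case: Of.
Qed.

Lemma sim_iter k : 0 < k -> sim f (iter k f).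
Proof.
(* The two comparisons amount to 1 < (k+2)k and k < k+2. *)
move=> k_gt0; exists k.+2; split=> //; exists 0 => n _.
  by rewrite -iterM; apply: (@iter_Omega_ltn 1); nia.
exact: iter_Omega_ltn.
Qed.

Lemma bounded_iter_leq rho k l :
  k <= l -> bounded rho (iter k f) -> bounded rho (iter l f).
Proof.
by move=> le_kl brho n m /brho/lei_trans; apply; apply: iter_Omega_leq.
Qed.

(* Only finitely many values escape the eventual bound, and those are
   absorbed by further iterations since each one increases its argument. *)
Lemma bounded_sim rho g : sim f g -> bounded rho g ->
  exists k, bounded rho (iter k f).
Proof.
move=> [k [_ _ [N ltN]]] brho.
exists (k + \max_(i < N) rho i) => n m le_mn.
case: (leqP N n) => [/ltN/ltiW le_g|lt_nN].
  apply: lei_trans (brho n m le_mn) (lei_trans le_g _).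
  by apply: iter_Omega_leq; rewrite leq_addr.
apply: lei_trans (iter_Omega_add _ n) => /=.
have := leq_bigmax (F := fun i : 'I_N => rho i) (Ordinal (leq_ltn_trans le_mn lt_nN)).
by move=> /= le_max; lia.
Qed.

End OmegaIter.

(** By [bounded_sim] and [sim_iter], the iterates of one representative [f] serve as bounds in place
    of all members of the growth, and their exponents can be added and compared. *)
Lemma ScompP alpha : growth alpha -> exists2 f, Omega_infty f &
  forall rho, Scomp alpha rho <-> exists rho' : nat -> nat,
    [/\ cancel rho rho', cancel rho' rho, computable rho, computable rho' &
        exists k, bounded rho (iter k f) /\ bounded rho' (iter k f)].
Proof.
move=> [f Of alphaP]; exists f => // rho; split=> -[rho' [rK rK' cr cr' [g]]].
  move=> /alphaP[_ fg] [br br']; exists rho'; split=> //.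
  have [k bk] := bounded_sim Of fg br; have [l bl] := bounded_sim Of fg br'.
  exists (maxn k l); split.
    exact: (bounded_iter_leq Of (leq_maxl _ _) bk).
  exact: (bounded_iter_leq Of (leq_maxr _ _) bl).
(* In this direction [g] is the exponent; it is raised by one because it may be 0, and the zeroth
   iterate does not lie in [Omega_infty]. *)
move=> [br br']; exists rho'; split=> //; exists (iter g.+1 f).
  by apply/alphaP; split; [apply: Omega_infty_iter | apply: sim_iter].
by split; apply: (bounded_iter_leq Of (leqnSn g)).
Qed.

Lemma Scomp_comp alpha rho1 rho2 : growth alpha ->
  Scomp alpha rho1 -> Scomp alpha rho2 -> Scomp alpha (rho1 \o rho2).
Proof.
move=> /ScompP[f Of fP] /fP[r1 [K1 K1' c1 c1' [k [b1 b1']]]].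
move=> /fP[r2 [K2 K2' c2 c2' [l [b2 b2']]]]; apply/fP; exists (r2 \o r1).
have bcomp p q i j : bounded p (iter i f) -> bounded q (iter j f) ->
    bounded (p \o q) (iter (i + j) f).
  move=> bp bq n m /bq le_q; rewrite iterD.
  exact: lei_trans (bp _ _ (leqnn _)) (iter_Omega_lei Of i le_q).
split; try exact: can_comp; try exact: computable_comp.
by exists (k + l); split; [apply: bcomp | rewrite addnC; apply: bcomp].
Qed.

(** Each application of [f] raises a finite argument by at least 1, so the [c]-th iterate bounds any
    permutation with displacement at most [c], whatever the growth. *)
Lemma Scomp_displacement alpha c rho rho' : growth alpha ->
  cancel rho rho' -> cancel rho' rho -> computable rho -> computable rho' ->
  (forall n, rho n <= n + c) -> (forall n, rho' n <= n + c) -> Scomp alpha rho.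
Proof.
move=> /ScompP[f Of fP] rK rK' cr cr' dr dr'; apply/fP; exists rho'.
split=> //; exists c; split=> n m le_mn;
  apply: lei_trans (iter_Omega_add Of c n) => /=.
  by have := dr m; lia.
by have := dr' m; lia.
Qed.

(** * Transpositions *)

Definition transp (a b n : nat) : nat :=
  if n == a then b else if n == b then a else n.

Lemma transpK a b : involutive (transp a b).
Proof. by rewrite /transp => n; do ![case: eqP]; lia. Qed.

Lemma transpC a b : transp a b =1 transp b a.
Proof. by rewrite /transp => n; do ![case: eqP]; lia. Qed.

Lemma transp_conj u a b n :
  injective u -> u (transp a b n) = transp (u a) (u b) (u n).
Proof. by move=> uI; rewrite /transp !(inj_eq uI); do 2?case: ifP. Qed.

Lemma Scomp_transp alpha a b : growth alpha -> Scomp alpha (transp a b).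
Proof.
move=> galpha.
have ct : computable (transp a b).
  apply/computableP/recursive_if.
  - exact: recursive_eq (recursive_nth _ _) (recursive_const _ _).
  - exact: recursive_const.
  apply: recursive_if.
  - exact: recursive_eq (recursive_nth _ _) (recursive_const _ _).
  - exact: recursive_const.
  - exact: recursive_nth.
have dt n : transp a b n <= n + (a + b).
  by rewrite /transp; do ![case: eqP]; lia.
exact: (Scomp_displacement galpha (@transpK a b) (@transpK a b) ct ct dt dt).
Qed.

Lemma Scomp_move3 alpha c d e : growth alpha -> uniq [:: c; d; e] ->
  exists2 u, Scomp alpha u & [/\ u c = 0, u d = 2 & u e = 4].
Proof.
move=> galpha; rewrite /= !inE !andbT negb_or => /andP[/andP[cd ce] de].
(* The points are put in place one at a time; by distinctness, each transposition fixes the targets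
   already reached. *)
pose u1 := transp c 0; pose u2 := transp (u1 d) 2; pose u3 := transp (u2 (u1 e)) 4.
exists (u3 \o (u2 \o u1)).
  by do 2?apply: Scomp_comp => //; apply: Scomp_transp.
move: cd ce de; rewrite /= /u3 /u2 /u1 /transp.
by split; do ![case: eqP]; lia.
Qed.

(** * The shift and the diagonal permutation *)

Lemma recursive_div n F d : 0 < d -> recursive n F -> recursive n (fun v => F v %/ d).
Proof.
move=> d_gt0 recF.
have recb : recursive n.+1 (fun w => F (behead w) < (nth 0 w 0).+1 * d).
  apply: recursive_leq; first exact/recursive_succ/(recursive_behead recF).
  by apply: recursive_mul (recursive_const _ _); apply/recursive_succ/recursive_nth.
have [v _|h rech hP] := recursive_min recb.
  by exists (F v) => /=; nia.
apply: recursive_ext rech => v sv; have [/= lt_h minh] := hP v sv.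
apply/eqP; rewrite eqn_leq minh /= ?ltn_ceil //.
by rewrite -ltnS ltn_divLR.
Qed.

Lemma recursive_mod n F d : 0 < d -> recursive n F -> recursive n (fun v => F v %% d).
Proof.
move=> d_gt0 recF.
have := recursive_sub recF (recursive_mul (recursive_div d_gt0 recF) (recursive_const _ d)).
by apply: recursive_ext => v _; rewrite {1}(divn_eq (F v) d) addKn.
Qed.

(* A permutation of N all of whose orbits are infinite: the even numbers move
   up, and the odd ones feed them from below. *)
Definition shift4 n :=
  if n %% 2 == 0 then n + 4 else if n < 4 then n.-1 else n - 4.
Definition unshift4 n :=
  if n %% 2 == 0 then if n < 4 then n.+1 else n - 4 else n + 4.

Lemma shift4K : cancel shift4 unshift4.
Proof.
rewrite /shift4 /unshift4 => n; case: (n %% 2 =P 0) => n2.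
  by rewrite ifT ?ifF; lia.
by case: (ltnP n 4) => n4; [rewrite !ifT | rewrite ifF]; lia.
Qed.

Lemma unshift4K : cancel unshift4 shift4.
Proof.
rewrite /shift4 /unshift4 => n; case: (n %% 2 =P 0) => n2.
  by case: (ltnP n 4) => n4; [rewrite ifF ?ifT | rewrite ifT]; lia.
by rewrite !ifF; lia.
Qed.

Lemma Scomp_shift4 alpha :
  growth alpha -> Scomp alpha shift4 /\ Scomp alpha unshift4.
Proof.
move=> galpha.
have rec0 : recursive 1 (fun v => nth 0 v 0) by exact: recursive_nth.
have rec4 : recursive 1 (fun=> 4) by exact: recursive_const.
have rec_even : recursive 1 (fun v => nth 0 v 0 %% 2 == 0).
  exact: recursive_eq (recursive_mod _ rec0) (recursive0 _).
have rec_lt : recursive 1 (fun v => nth 0 v 0 < 4).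
  exact: recursive_leq (recursive_succ rec0) rec4.
have cs : computable shift4.
  apply/computableP/recursive_if => //; first exact: recursive_add.
  by apply: recursive_if => //; [apply: recursive_pred | apply: recursive_sub].
have cu : computable unshift4.
  apply/computableP/recursive_if => //; last exact: recursive_add.
  by apply: recursive_if => //; [apply: recursive_succ | apply: recursive_sub].
have ds n : shift4 n <= n + 4 by rewrite /shift4; do ![case: ifP]; lia.
have du n : unshift4 n <= n + 4 by rewrite /unshift4; do ![case: ifP]; lia.
split; first exact: (Scomp_displacement galpha shift4K unshift4K).
exact: (Scomp_displacement galpha unshift4K shift4K).
Qed.

(** Of the two points 4i and 4i+2 moved by x_i, both are fixed when [e i] is false and only the
    second one when it is true. Hence [diag e] commutes with x_i exactly when [e i] is false. *)
Definition diag (e : nat -> bool) n :=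
  if (n %% 4 == 0) && e (n %/ 4) then n.+1
  else if (n %% 4 == 1) && e (n %/ 4) then n.-1 else n.

Lemma diagK e : involutive (diag e).
Proof.
rewrite /diag => n; case en: (e (n %/ 4)); last by rewrite !andbF !en !andbF.
rewrite !andbT; case: (n %% 4 =P 0) => n0.
  have -> : n.+1 %/ 4 = n %/ 4 by lia.
  by rewrite en !andbT ifF ?ifT; lia.
case: (n %% 4 =P 1) => n1; last by rewrite en !andbT !ifF //; lia.
have -> : n.-1 %/ 4 = n %/ 4 by lia.
by rewrite en !andbT ifT; lia.
Qed.

Lemma Scomp_diag alpha (e : nat -> bool) : growth alpha ->
  recursive 1 (fun v => e (nth 0 v 0)) -> Scomp alpha (diag e).
Proof.
move=> galpha rece.
have rec0 : recursive 1 (fun v => nth 0 v 0) by exact: recursive_nth.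
have rec_e4 : recursive 1 (fun v => e (nth 0 v 0 %/ 4)).
  apply: (recursive1_comp (f := fun n => nat_of_bool (e n)) rece).
  exact: recursive_div.
have rec_mod c : recursive 1 (fun v => nth 0 v 0 %% 4 == c).
  exact: recursive_eq (recursive_mod _ rec0) (recursive_const _ _).
have cd : computable (diag e).
  apply/computableP/recursive_if; [exact: recursive_and | exact: recursive_succ |].
  by apply: recursive_if; [exact: recursive_and | exact: recursive_pred |].
have dd n : diag e n <= n + 1 by rewrite /diag; do ![case: ifP]; lia.
exact: (Scomp_displacement galpha (@diagK e) (@diagK e) cd cd dd dd).
Qed.

(** * Diagonalization *)

(** Commutation and the surjectivity of [rho] force [z] to equal [x], so [y] commutes with [z].
    Conjugating by [u], the transpositions (0 2) and (0 4) would commute, but their two products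
    send 0 to 4 and to 2. *)
Lemma commuting_certificate_sound (rho rho' u u' x y z : nat -> nat) :
  cancel rho' rho -> cancel u' u -> rho \o x =1 x \o rho ->
  z \o rho =1 rho \o x -> y \o x =1 x \o y ->
  u \o z =1 transp 0 2 \o u -> u \o y =1 transp 0 4 \o u -> False.
Proof.
move=> rK uK rx zr yx uz uy.
have zx n : z n = x n by rewrite -(rK n); have := zr (rho' n); rewrite rx.
have tt n : transp 0 2 (transp 0 4 n) = transp 0 4 (transp 0 2 n).
  rewrite -(uK n); move: (u' n) => m.
  have /= <- := uy m; have /= <- := uz (y m); have /= <- := uz m.
  by have /= <- := uy (z m); rewrite !zx; have /= -> := yx m.
by have := tt 0.
Qed.

Lemma transp_commuting (rho : nat -> nat) a b : injective rho ->
  rho \o transp a b =1 transp a b \o rho \/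
  exists c d e, [/\ uniq [:: c; d; e],
    transp c d \o rho =1 rho \o transp a b &
    transp c e \o transp a b =1 transp a b \o transp c e].
Proof.
move=> rI; have conj := transp_conj a b _ rI.
(* If the conjugate (c d) has a point [c] outside {a, b}, pair [c] with a point larger than all the
   others: the new transposition is disjoint from (a b) and meets (c d) in [c] alone. The cases
   below find such a [c] among [rho a] and [rho b]. *)
have other c d : c != d -> c != a -> c != b ->
    (forall n, rho (transp a b n) = transp c d (rho n)) ->
    exists c d e, [/\ uniq [:: c; d; e],
      transp c d \o rho =1 rho \o transp a b &
      transp c e \o transp a b =1 transp a b \o transp c e].
  move=> cd ca cb rcd; exists c, d, (a + b + c + d).+1; split.
  - by rewrite /= !inE; lia.
  - by move=> n /=; rewrite rcd.
  - move=> n /=; have := transp_conj a b n (inv_inj (@transpK c (a + b + c + d).+1)).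
    by move=> ->; congr (transp _ _ _); rewrite /transp; do ![case: eqP]; lia.
case: (rho a =P a) => [ra|/eqP ra].
  case: (rho b =P b) => [rb|/eqP rb]; first by left=> n; rewrite /= conj ra rb.
  have [ab|ab] := eqVneq a b; first by rewrite -ab ra eqxx in rb.
  right; apply: (other (rho b) a) => //; first by rewrite -ra (inj_eq rI) eq_sym.
    by rewrite -ra (inj_eq rI) eq_sym.
  by move=> n; rewrite conj ra transpC.
have [ab|ab] := eqVneq a b.
  by left=> n; rewrite /= conj -ab /transp; do ![case: eqP]; lia.
have rab : rho a != rho b by rewrite (inj_eq rI).
have [rab'|rab'] := eqVneq (rho a) b; last first.
  by right; apply: (other (rho a) (rho b)) => // n; rewrite conj.
have [rba|rba] := eqVneq (rho b) a.
  by left=> n; rewrite /= conj rab' rba transpC.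
right; apply: (other (rho b) (rho a)) => [||| n] //.
- by rewrite eq_sym.
- by rewrite eq_sym -{1}rab'.
- by rewrite conj transpC.
Qed.

Theorem theorem4p1 (alpha : (natinf -> natinf) -> Prop) (halpha : growth alpha) :
  ~ computably_enumerable (Scomp alpha).
Proof.
move=> [nu [nuS nu_onto /semidec_ce3 semi3]].
(* Equality of two products is confirmed by an index [q] of their common value, which exists because
   the group is closed under composition and [nu] is onto. *)
have semi_eq n A B C D : recursive n A -> recursive n B -> recursive n C ->
    recursive n D -> semidec n (fun v => nu (A v) \o nu (B v) =1 nu (C v) \o nu (D v)).
  move=> recA recB recC recD.
  have : semidec n (fun v => exists q,
      nu (A v) \o nu (B v) =1 nu q /\ nu (C v) \o nu (D v) =1 nu q).
    apply: semidec_ex; apply: semidec_and.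
      apply: (semidec_comp (T := fun w =>
        [:: A (behead w); B (behead w); nth 0 w 0]) semi3) => // -[|[|[|//]]] _ /=.
      - exact: recursive_behead recA.
      - exact: recursive_behead recB.
      - exact: recursive_nth.
    apply: (semidec_comp (T := fun w =>
      [:: C (behead w); D (behead w); nth 0 w 0]) semi3) => // -[|[|[|//]]] _ /=.
    - exact: recursive_behead recC.
    - exact: recursive_behead recD.
    - exact: recursive_nth.
  apply: semidec_ext => v _; split=> [[q [ABq CDq]] n'|ABCD].
    by rewrite ABq CDq.
  have [q qP] := nu_onto _ (Scomp_comp halpha (nuS (A v)) (nuS (B v))).
  by exists q; split=> n'; rewrite ?ABCD qP ?ABCD.
have [Ss Su] := Scomp_shift4 halpha.
have [S SP] := nu_onto _ Ss.
have [T02 T02P] := nu_onto _ (Scomp_transp 0 2 halpha).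
have [T04 T04P] := nu_onto _ (Scomp_transp 0 4 halpha).
(* [next] sends an index of a permutation to one of its conjugate by [shift4]. Conjugation is
   written as an equality of two products, which [semi_eq] can confirm without inverses. *)
have [||next rec_next nextP] := @semidec_uniformize 1
    (fun t' v => nu S \o nu (nth 0 v 0) =1 nu t' \o nu S).
- apply: semi_eq; try exact: recursive_const; try exact: recursive_nth.
  exact: (recursive_nth_iter _ 1).
- move=> v _; have [t' t'P] := nu_onto _ (Scomp_comp halpha Ss
    (Scomp_comp halpha (nuS (nth 0 v 0)) Su)).
  by exists t' => n; rewrite /= t'P /= !SP shift4K.
pose t i := iteri i (fun _ t => next [:: t]) T02.
have rec_t : recursive 1 (fun v => t (nth 0 v 0)).
  apply: (recursive_iteri (S := fun w => next [:: nth 0 w 1])).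
  - exact: recursive_nth.
  - exact: recursive_const.
  - apply: (recursive_comp (T := fun w => [:: nth 0 w 1]) rec_next) => // -[] //= _.
    exact: recursive_nth.
have tP i : nu (t i) =1 transp (4 * i) (4 * i + 2).
  elim: i => [|i IHi] n; first by rewrite /= T02P.
  (* [shift4] adds 4 to even numbers, so it conjugates x_i to x_(i+1). *)
  have /= := nextP [:: t i] erefl (unshift4 n).
  rewrite !SP unshift4K IHi (transp_conj _ _ _ (can_inj shift4K)) unshift4K => <-.
  congr transp; rewrite /shift4 ifT; lia.
pose noncomm i := exists z y u,
  [/\ nu z \o nu i =1 nu i \o nu (t i), nu y \o nu (t i) =1 nu (t i) \o nu y,
      nu u \o nu z =1 nu T02 \o nu u & nu u \o nu y =1 nu T04 \o nu u].
have semi_noncomm : semidec 2 (fun w => noncomm (nth 0 (behead w) 0)).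
  (* Under the three quantifiers the sequence reads [u], [y], [z], the answer [b] of the search for
     [h], and [i]. *)
  pose r := recursive_nth_iter.
  have rti : recursive 5 (fun w => t (nth 0 (iter 4 behead w) 0)).
    exact: recursive1_comp rec_t (r _ 4 0).
  do 3!apply: semidec_ex.
  have := semidec_and
    (semidec_and (semi_eq _ _ _ _ _ (r 5 2 0) (r 5 4 0) (r 5 4 0) rti)
                 (semi_eq _ _ _ _ _ (r 5 1 0) rti rti (r 5 1 0)))
    (semidec_and
       (semi_eq _ _ _ _ _ (r 5 0 0) (r 5 2 0) (recursive_const _ T02) (r 5 0 0))
       (semi_eq _ _ _ _ _ (r 5 0 0) (r 5 1 0) (recursive_const _ T04) (r 5 0 0))).
  by apply: semidec_ext => v _ /=; split=> [[[? ?] [? ?]]|[? ? ? ?]].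
(* The search is for an answer, 0 or 1, that gets confirmed. One always exists by
   [transp_commuting], so [h] is a total recursive decision. *)
have [||h rec_h hP] := @semidec_uniformize 1 (fun b v =>
    (b == 0 /\ noncomm (nth 0 v 0)) \/
    (b == 1 /\ nu (nth 0 v 0) \o nu (t (nth 0 v 0)) =1
               nu (t (nth 0 v 0)) \o nu (nth 0 v 0))).
- have rec_eqn c : recursive 2 (fun w => nth 0 w 0 == c).
    exact: recursive_eq (recursive_nth _ _) (recursive_const _ _).
  have ri := recursive_nth_iter 2 1 0.
  have rti := recursive1_comp rec_t ri.
  apply: semidec_or; apply: semidec_and => //; try exact: semidec_dec.
  exact: (semi_eq _ _ _ _ _ ri rti rti ri).
- move=> v _; move: (nth 0 v 0) => i.
  have [rho' [/can_inj rI _ _ _ _]] := nuS i.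
  have [comm|[c [d [e [cde zr yx]]]]] :=
    transp_commuting (4 * i) (4 * i + 2) rI.
    by exists 1; right; split=> // n; have /= := comm n; rewrite !tP.
  exists 0; left; split=> //.
  have [u uS [uc ud ue]] := Scomp_move3 halpha cde.
  have [_ [/can_inj uI _ _ _ _]] := uS.
  have [z zP] := nu_onto _ (Scomp_transp c d halpha).
  have [y yP] := nu_onto _ (Scomp_transp c e halpha).
  have [k kP] := nu_onto _ uS.
  exists z, y, k; split=> n /=; rewrite ?zP ?yP ?kP ?tP ?T02P ?T04P.
  - exact: zr.
  - by rewrite ?yP ?tP; apply: yx.
  - by rewrite transp_conj // uc ud.
  - by rewrite transp_conj // uc ue.
pose e i := h [:: i] == 1.
have rec_e : recursive 1 (fun v => e (nth 0 v 0)).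
  apply: recursive_eq (recursive_const _ _).
  apply: (recursive_comp (T := fun v => [:: nth 0 v 0]) rec_h) => // -[] //= _.
  exact: recursive_nth.
have [i iP] := nu_onto _ (Scomp_diag halpha rec_e).
have [d0 d2] : diag e (4 * i) = 4 * i + e i /\ diag e (4 * i + 2) = 4 * i + 2.
  have [m0 q0 m2] : [/\ 4 * i %% 4 = 0, 4 * i %/ 4 = i & (4 * i + 2) %% 4 = 2].
    by split; lia.
  by rewrite /diag m0 q0 m2 /=; case: (e i); lia.
(* If the answer is 0, [nu i] fixes both points of x_i and so commutes with it, against the
   certificate of noncommutation. *)
have [[h0 [z [y [u [zr yx uz uy]]]]]|[h1 comm]] := hP [:: i] erefl.
  have ei : e i = false by rewrite /e (eqP h0).
  have [rho' [_ rK _ _ _]] := nuS i; have [u' [_ uK _ _ _]] := nuS u.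
  apply: (commuting_certificate_sound rK uK _ zr yx) => n /=.
  - rewrite !tP !iP (transp_conj _ _ _ (inv_inj (@diagK e))).
    by rewrite d0 d2 ei addn0.
  - by have /= -> := uz n; rewrite T02P.
  - by have /= -> := uy n; rewrite T04P.
(* If the answer is 1, the two products differ at 4i: [nu i] after x_i gives 4i+2, and x_i after
   [nu i] gives 4i+1. *)
have := comm (4 * i); rewrite /= !tP !iP {1}/transp eqxx d0 d2 /e h1.
by rewrite /transp !ifF; lia.
Qed.
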